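(* Let $\mathrm{CS}$ be an arbitrary constant specification for $\mathsf{JTO}$. Define $$\mathtt{contract}':=\boxdot\big[\big((\bigcirc\neg[\mathtt a]^{\mathcal O}_e\mathtt{pay})\,\mathcal W\,\mathtt{winfirst}_e\big)\wedge\big(\mathtt{winfirst}_e\to((\bigcirc[\mathtt a]^{\mathcal O}_e\mathtt{pay})\,\mathcal W\,\mathtt{pay})\big)\big],$$ $$\mathtt{court}':=\mathtt{true}_{10}\big[(\neg\mathtt{win}_p\leftrightarrow\mathtt{winfirst}_e)\wedge(\mathtt{win}_p\to((\bigcirc[\mathtt v_p]^{\mathcal O}_e\mathtt{pay})\,\mathcal W\,\mathtt{pay}))\wedge(\neg\mathtt{win}_p\to\Box\neg[\mathtt v_e]^{\mathcal O}_e\mathtt{pay})\big].$$ Then the set $\{\mathtt{contract}',\ \mathtt{court}',\ \mathtt{time}=10\}$ is consistent in $\mathsf{JTO}_{\mathrm{CS}}$, i.e. $\mathtt{contract}',\mathtt{court}',\mathtt{time}=10\not\vdash_{\mathrm{CS}}\bot$.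
   Context: **Language.** The set of agents is $\mathrm{Ag}=\{p,e,j\}$ (Protagoras, Euathlus, judge); $\mathrm{Const},\mathrm{Var},\mathrm{Prop}$ are countable sets of justification constants, justification variables and atomic propositions. $\mathrm{Prop}$ contains distinct atoms $\mathtt{win}_p$, $\mathtt{winfirst}_e$, $\mathtt{pay}$, and $\mathrm{Var}$ contains distinct variables $\mathtt a$ (the agreement), $\mathtt v_p$, $\mathtt v_e$ (the judge's verdict in favor of Protagoras, resp. Euathlus). Epistemic terms: $t::=c\mid x\mid {!t}\mid t+t\mid t\cdot t$. Normative terms: $s::=c\mid x\mid \ddagger s\mid s\cdot s$ ($c\in\mathrm{Const}$, $x\in\mathrm{Var}$). Formulas: $\varphi::=q\mid\bot\mid\varphi\to\varphi\mid\bigcirc\varphi\mid\mathsf Y_w\varphi\mid\varphi\,\mathcal U\,\varphi\mid\varphi\,\mathcal S\,\varphi\mid[t]_i\varphi\mid[s]^{\mathcal O}_i\varphi$ ($q\in\mathrm{Prop}$, $i\in\mathrm{Ag}$, $t$ epistemic, $s$ normative). Abbreviations: $\neg\varphi:=\varphi\to\bot$, $\top:=\neg\bot$, $\varphi\vee\psi:=\neg\varphi\to\psi$, $\varphi\wedge\psi:=\neg(\neg\varphi\vee\neg\psi)$, $\leftrightarrow$ as usual, $\mathsf Y_s\varphi:=\neg\mathsf Y_w\neg\varphi$, $\Diamond\varphi:=\top\,\mathcal U\,\varphi$, $\Box\varphi:=\neg\Diamond\neg\varphi$, $\blacksquare\varphi:=\neg(\top\,\mathcal S\,\neg\varphi)$,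 $\boxdot\varphi:=\blacksquare\varphi\wedge\Box\varphi$, $\varphi\,\mathcal W\,\psi:=(\varphi\,\mathcal U\,\psi)\vee\Box\varphi$, $\langle s\rangle^{\mathcal P}_i\varphi:=\neg[s]^{\mathcal O}_i\neg\varphi$; for $m\in\mathbb N$, $(\mathtt{time}=m):=\mathsf Y_s^m\mathsf Y_w\bot$ ($m$-fold $\mathsf Y_s$) and $\mathtt{true}_m(\varphi):=\boxdot(\mathtt{time}=m\to\varphi)$. **Axioms** (all instances, all $i\in\mathrm{Ag}$): propositional tautologies; $\ast(\varphi\to\psi)\to(\ast\varphi\to\ast\psi)$ for $\ast\in\{\bigcirc,\Box,\blacksquare,\mathsf Y_w\}$; $\bigcirc\neg\varphi\leftrightarrow\neg\bigcirc\varphi$; $\Box(\varphi\to\bigcirc\varphi)\to(\varphi\to\Box\varphi)$; $\varphi\,\mathcal U\,\psi\to\Diamond\psi$; $\varphi\,\mathcal U\,\psi\leftrightarrow\psi\vee(\varphi\wedge\bigcirc(\varphi\,\mathcal U\,\psi))$; $\mathsf Y_s\varphi\to\mathsf Y_w\varphi$; $\top\,\mathcal S\,\mathsf Y_w\bot$; $\blacksquare(\varphi\to\mathsf Y_w\varphi)\to(\varphi\to\blacksquare\varphi)$; $(\varphi\,\mathcal S\,\psi)\to(\top\,\mathcal S\,\psi)$; $\varphi\,\mathcal S\,\psi\leftrightarrow\psi\vee(\varphi\wedge\mathsf Y_s(\varphi\,\mathcal S\,\psi))$; $\varphi\to\bigcirc\mathsf Y_s\varphi$; $\varphi\to\mathsf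 Y_w\bigcirc\varphi$; $[t]_i(\varphi\to\psi)\to([s]_i\varphi\to[t\cdot s]_i\psi)$; $[t]_i\varphi\to[t+s]_i\varphi$; $[s]_i\varphi\to[t+s]_i\varphi$; $[t]_i\varphi\to\varphi$; $[t]_i\varphi\to[!t]_i[t]_i\varphi$; $[t]^{\mathcal O}_i(\varphi\to\psi)\to([s]^{\mathcal O}_i\varphi\to[t\cdot s]^{\mathcal O}_i\psi)$; $[t]^{\mathcal O}_i\varphi\to\langle t\rangle^{\mathcal P}_i\varphi$; $[\ddagger t]^{\mathcal O}_i([t]^{\mathcal O}_i\varphi\to\varphi)$. **Constant specifications.** A constant specification $\mathrm{CS}$ is a set of formulas of the form $[c_n]_{i_n}\cdots[c_1]_{i_1}\varphi$ or $[c_n]^{\mathcal O}_{i_n}\cdots[c_1]^{\mathcal O}_{i_1}\varphi$ with $n\ge1$, $c_k\in\mathrm{Const}$, $i_k\in\mathrm{Ag}$, $\varphi$ an axiom instance, which is downward closed: for $n>1$, if such a formula is in $\mathrm{CS}$, so is the one obtained by deleting its outermost operator. **Derivability.** $\vdash_{\mathrm{CS}}$ is derivability in the Hilbert system $\mathsf{JTO}_{\mathrm{CS}}$ with these axioms, modus ponens, necessitation (from $\vdash\varphi$ infer $\vdash\ast\varphi$) for $\ast\in\{\bigcirc,\mathsf Y_w,\Box,\blacksquare\}$, and: infer $\vdash\varphi$ for each $\varphi\in\mathrm{CS}$. $T\vdash_{\mathrm{CS}}\varphi$ means $\vdash_{\mathrm{CS}}(\psi_1\wedge\dots\wedge\psi_k)\to\varphi$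 for some $\psi_1,\dots,\psi_k\in T$. *)

(* Defs.v *)
From Stdlib Require List.
From mathcomp Require Import all_boot classical_sets.

Set Implicit Arguments.
Unset Strict Implicit.
Unset Printing Implicit Defensive.

Local Open Scope classical_set_scope.

Inductive agent : Set := protagoras | euathlus | judge.

(* [countType] allows both finite and countably infinite sets of symbols. *)
Record language := Language {
  const : countType;
  var : countType;
  atom : countType;
  win_p : atom;
  winfirst_e : atom;
  pay : atom;
  atoms_distinct : uniq [:: win_p; winfirst_e; pay];
  var_a : var;
  var_vp : var;
  var_ve : var;
  vars_distinct : uniq [:: var_a; var_vp; var_ve]
}.

Inductive eterm (L : language) : Type :=
| EConst of const L
| EVar of var L
| EBang of eterm L
| ESum of eterm L & eterm L
| EApp of eterm L & eterm L.

Inductive nterm (L : language) : Type :=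
| NConst of const L
| NVar of var L
| NDagger of nterm L
| NApp of nterm L & nterm L.

Inductive formula (L : language) : Type :=
| Atom of atom L
| Bot
| Imp of formula L & formula L
| Next of formula L
| WPrev of formula L
| Until of formula L & formula L
| Since of formula L & formula L
| Just of eterm L & agent & formula L
| Oblig of nterm L & agent & formula L.

Arguments Bot {L}.

Declare Scope jto_scope.
Delimit Scope jto_scope with J.
Bind Scope jto_scope with formula.
Local Open Scope jto_scope.

Notation "⊥" := Bot : jto_scope.
Notation "φ ⟶ ψ" := (Imp φ ψ) (at level 90, right associativity) : jto_scope.
Notation "○ φ" := (Next φ) (at level 75, right associativity) : jto_scope.
Notation "⟦ t ⟧_ i φ" := (Just t i φ)
  (at level 75, i at level 0, φ at level 75, format "⟦ t ⟧_ i  φ") : jto_scope.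
Notation "⟦ s ⟧^O_ i φ" := (Oblig s i φ)
  (at level 75, i at level 0, φ at level 75, format "⟦ s ⟧^O_ i  φ") : jto_scope.

Section Abbreviations.
Context {L : language}.
Implicit Types φ ψ : formula L.

Definition Neg φ := φ ⟶ ⊥.
Definition Top : formula L := Neg ⊥.
Definition Or φ ψ := Neg φ ⟶ ψ.
Definition And φ ψ := Neg (Or (Neg φ) (Neg ψ)).
Definition Iff φ ψ := And (φ ⟶ ψ) (ψ ⟶ φ).
Definition SPrev φ := Neg (WPrev (Neg φ)).
Definition Eventually φ := Until Top φ.
Definition Henceforth φ := Neg (Eventually (Neg φ)).
Definition Hitherto φ := Neg (Since Top (Neg φ)).
Definition Always φ := And (Hitherto φ) (Henceforth φ).
Definition WUntil φ ψ := Or (Until φ ψ) (Henceforth φ).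
Definition Permit (s : nterm L) (i : agent) φ := Neg (⟦s⟧^O_i (Neg φ)).

End Abbreviations.

Notation "⊤" := Top : jto_scope.
Notation "¬ φ" := (Neg φ) (at level 75, right associativity) : jto_scope.
Notation "φ ∧ ψ" := (And φ ψ) (at level 80, right associativity) : jto_scope.
Notation "φ ∨ ψ" := (Or φ ψ) (at level 85, right associativity) : jto_scope.
Notation "φ ⟷ ψ" := (Iff φ ψ) (at level 95, no associativity) : jto_scope.
Notation "◇ φ" := (Eventually φ) (at level 75, right associativity) : jto_scope.
Notation "□ φ" := (Henceforth φ) (at level 75, right associativity) : jto_scope.
Notation "■ φ" := (Hitherto φ) (at level 75, right associativity) : jto_scope.
Notation "⊡ φ" := (Always φ) (at level 75, right associativity) : jto_scope.

Definition time_is {L : language} (m : nat) : formula L :=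
  iter m SPrev (WPrev ⊥).

Definition true_at {L : language} (m : nat) (φ : formula L) : formula L :=
  ⊡ (time_is m ⟶ φ).

(* Every formula other than ⊥ and implications counts as a propositional
   letter, so the tautologies include all their substitution instances. *)
Fixpoint prop_eval (L : language) (v : formula L -> bool) (φ : formula L) : bool :=
  match φ with
  | ⊥ => false
  | ψ ⟶ χ => prop_eval v ψ ==> prop_eval v χ
  | _ => v φ
  end.

Definition tautology (L : language) (φ : formula L) : Prop :=
  forall v : formula L -> bool, prop_eval v φ.

Inductive axiom (L : language) : formula L -> Prop :=
| Ax_taut φ : tautology φ -> axiom φ
| Ax_next_K φ ψ : axiom (○ (φ ⟶ ψ) ⟶ (○ φ ⟶ ○ ψ))
| Ax_henceforth_K φ ψ : axiom (□ (φ ⟶ ψ) ⟶ (□ φ ⟶ □ ψ))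
| Ax_hitherto_K φ ψ : axiom (■ (φ ⟶ ψ) ⟶ (■ φ ⟶ ■ ψ))
| Ax_wprev_K φ ψ : axiom (WPrev (φ ⟶ ψ) ⟶ (WPrev φ ⟶ WPrev ψ))
| Ax_next_fun φ : axiom (○ ¬ φ ⟷ ¬ ○ φ)
| Ax_henceforth_ind φ : axiom (□ (φ ⟶ ○ φ) ⟶ (φ ⟶ □ φ))
| Ax_until_eventually φ ψ : axiom (Until φ ψ ⟶ ◇ ψ)
| Ax_until_fix φ ψ : axiom (Until φ ψ ⟷ ψ ∨ (φ ∧ ○ Until φ ψ))
| Ax_sprev_wprev φ : axiom (SPrev φ ⟶ WPrev φ)
| Ax_initial : axiom (Since ⊤ (WPrev ⊥))
| Ax_hitherto_ind φ : axiom (■ (φ ⟶ WPrev φ) ⟶ (φ ⟶ ■ φ))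
| Ax_since_once φ ψ : axiom (Since φ ψ ⟶ Since ⊤ ψ)
| Ax_since_fix φ ψ : axiom (Since φ ψ ⟷ ψ ∨ (φ ∧ SPrev (Since φ ψ)))
| Ax_next_sprev φ : axiom (φ ⟶ ○ SPrev φ)
| Ax_wprev_next φ : axiom (φ ⟶ WPrev (○ φ))
| Ax_just_app t s i φ ψ :
    axiom (⟦t⟧_i (φ ⟶ ψ) ⟶ (⟦s⟧_i φ ⟶ ⟦EApp t s⟧_i ψ))
| Ax_just_suml t s i φ : axiom (⟦t⟧_i φ ⟶ ⟦ESum t s⟧_i φ)
| Ax_just_sumr t s i φ : axiom (⟦s⟧_i φ ⟶ ⟦ESum t s⟧_i φ)
| Ax_just_refl t i φ : axiom (⟦t⟧_i φ ⟶ φ)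
| Ax_just_introspect t i φ : axiom (⟦t⟧_i φ ⟶ ⟦EBang t⟧_i ⟦t⟧_i φ)
| Ax_oblig_app t s i φ ψ :
    axiom (⟦t⟧^O_i (φ ⟶ ψ) ⟶ (⟦s⟧^O_i φ ⟶ ⟦NApp t s⟧^O_i ψ))
| Ax_oblig_permit t i φ : axiom (⟦t⟧^O_i φ ⟶ Permit t i φ)
| Ax_oblig_ideal t i φ : axiom (⟦NDagger t⟧^O_i (⟦t⟧^O_i φ ⟶ φ)).

(* For l = [:: (c_n, i_n); ..; (c_1, i_1)], these are [c_n]_{i_n} .. [c_1]_{i_1} φ
   and its normative counterpart. *)
Definition just_chain (L : language) (l : seq (const L * agent)) (φ : formula L) :=
  foldr (fun ci ψ => ⟦EConst ci.1⟧_(ci.2) ψ) φ l.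

Definition oblig_chain (L : language) (l : seq (const L * agent)) (φ : formula L) :=
  foldr (fun ci ψ => ⟦NConst ci.1⟧^O_(ci.2) ψ) φ l.

Record constant_specification (L : language) (CS : set (formula L)) : Prop := {
  cs_form : forall θ, CS θ -> exists l φ,
    l <> [::] /\ axiom φ /\ (θ = just_chain l φ \/ θ = oblig_chain l φ);
  cs_just_down : forall ci l φ, l <> [::] -> axiom φ ->
    CS (just_chain (ci :: l) φ) -> CS (just_chain l φ);
  cs_oblig_down : forall ci l φ, l <> [::] -> axiom φ ->
    CS (oblig_chain (ci :: l) φ) -> CS (oblig_chain l φ)
}.

Inductive provable (L : language) (CS : set (formula L)) : formula L -> Prop :=
| Pr_axiom φ : axiom φ -> provable CS φ
| Pr_cs φ : CS φ -> provable CS φ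
| Pr_mp φ ψ : provable CS (φ ⟶ ψ) -> provable CS φ -> provable CS ψ
| Pr_next φ : provable CS φ -> provable CS (○ φ)
| Pr_wprev φ : provable CS φ -> provable CS (WPrev φ)
| Pr_henceforth φ : provable CS φ -> provable CS (□ φ)
| Pr_hitherto φ : provable CS φ -> provable CS (■ φ).

Fixpoint conj_seq (L : language) (l : seq (formula L)) : formula L :=
  match l with
  | [::] => ⊤
  | [:: ψ] => ψ
  | ψ :: l' => ψ ∧ conj_seq l'
  end.

Definition derivable (L : language) (CS T : set (formula L)) (φ : formula L) : Prop :=
  exists l : seq (formula L), List.Forall T l /\ provable CS (conj_seq l ⟶ φ).

Definition consistent (L : language) (CS T : set (formula L)) : Prop :=
  ~ derivable CS T ⊥.

Definition contract' (L : language) : formula L :=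
  let pay := Atom (pay L) in
  let winfirst_e := Atom (winfirst_e L) in
  let a := NVar (var_a L) in
  ⊡ (WUntil (○ ¬ ⟦a⟧^O_euathlus pay) winfirst_e ∧
     (winfirst_e ⟶ WUntil (○ ⟦a⟧^O_euathlus pay) pay)).

Definition court' (L : language) : formula L :=
  let pay := Atom (pay L) in
  let win_p := Atom (win_p L) in
  let winfirst_e := Atom (winfirst_e L) in
  let v_p := NVar (var_vp L) in
  let v_e := NVar (var_ve L) in
  true_at 10
    ((¬ win_p ⟷ winfirst_e) ∧
     (win_p ⟶ WUntil (○ ⟦v_p⟧^O_euathlus pay) pay) ∧
     (¬ win_p ⟶ □ ¬ ⟦v_e⟧^O_euathlus pay)).

(* Main.v *)
(** Formulas are evaluated on the time line [nat], reading [⟦t⟧_i φ] as [φ]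
    and [⟦s⟧^O_i φ] as [φ] when [s] is not a variable and as falsity
    otherwise. Every operator with a compound or constant term is then
    factive, which validates the axioms and every constant specification,
    while the agreement and the verdicts oblige nobody. With [winfirst_e]
    always false and all the other atoms always true, [contract'] and [court']
    hold throughout, hence also at time 10. *)

Require Import Defs.
From mathcomp Require Import all_boot classical_sets boolp.

Local Open Scope classical_set_scope.
Local Open Scope jto_scope.

Definition is_nvar (L : language) (s : nterm L) : bool :=
  if s is NVar _ then true else false.

(** [Until] and [Since] may be witnessed at the present instant, as their fixpoint axioms demand.
    The value [True] of [WPrev] at 0 makes [WPrev ⊥] mark exactly the first instant. *)
Fixpoint sat (L : language) (n : nat) (φ : formula L) : Prop :=
  match φ with
  | Atom q => q != winfirst_e L
  | Bot => False
  | Imp ψ χ => sat L n ψ -> sat L n χ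
  | Next ψ => sat L n.+1 ψ
  | WPrev ψ => if n is k.+1 then sat L k ψ else True
  | Until ψ χ => exists m, [/\ n <= m, sat L m χ &
      forall k, n <= k < m -> sat L k ψ]
  | Since ψ χ => exists m, [/\ m <= n, sat L m χ &
      forall k, m < k <= n -> sat L k ψ]
  | Just _ _ ψ => sat L n ψ
  | Oblig s _ ψ => ~~ is_nvar L s /\ sat L n ψ
  end.

Arguments sat {L} n φ.

Section Satisfaction.
Context {L : language}.
Implicit Types (φ ψ : formula L) (n : nat).

(* Introducing with this lemma rather than by head reduction keeps the
   abbreviations in the antecedent folded. *)
Lemma sat_imp n φ ψ : (sat n φ -> sat n ψ) -> sat n (φ ⟶ ψ).
Proof. by []. Qed.

(** [And] is coded through negations, so extracting a conjunct takes double negation elimination. *)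
Lemma sat_and n φ ψ : sat n (φ ∧ ψ) <-> sat n φ /\ sat n ψ.
Proof.
split=> /= [H | [hφ hψ] H]; last by apply: H.
by split; apply: contrapT => h; apply: H => h' //.
Qed.

Lemma sat_or n φ ψ : sat n (φ ∨ ψ) <-> sat n φ \/ sat n ψ.
Proof.
split=> /= [H | [hφ h // | //]].
by have [?|/H] := pselect (sat n φ); [left | right].
Qed.

Lemma sat_iff n φ ψ : sat n (φ ⟷ ψ) <-> (sat n φ <-> sat n ψ).
Proof. by rewrite sat_and /=; split=> -[]. Qed.

Lemma sat_sprev n φ : sat n (SPrev φ) <-> (0 < n /\ sat n.-1 φ).
Proof.
case: n => [|n] /=; split=> [H | [_ hφ]] //.
by split=> //; apply: contrapT.
Qed.

Lemma sat_henceforth n φ : sat n (□ φ) <-> forall m, n <= m -> sat m φ.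
Proof.
split=> [H m le_nm | H [m [le_nm hφ _]]]; last exact: hφ (H m le_nm).
by apply: contrapT => hφ; apply: H; exists m; split=> // ? _.
Qed.

Lemma sat_hitherto n φ : sat n (■ φ) <-> forall m, m <= n -> sat m φ.
Proof.
split=> [H m le_mn | H [m [le_mn hφ _]]]; last exact: hφ (H m le_mn).
by apply: contrapT => hφ; apply: H; exists m; split=> // ? _.
Qed.

Lemma sat_always n φ : (forall m, sat m φ) -> sat n (⊡ φ).
Proof. by move=> H; rewrite sat_and sat_hitherto sat_henceforth. Qed.

Lemma sat_time_is m : sat m (time_is m : formula L).
Proof. by elim: m => [|m IHm] //; apply/sat_sprev. Qed.

(** Classically, truth at [n] is a boolean valuation of the propositional letters, and [prop_eval]
    under this valuation agrees with [sat n] on all formulas. *)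
Lemma sat_tautology n φ : tautology φ -> sat n φ.
Proof.
suff evalP ψ : prop_eval (fun χ => `[< sat n χ >]) ψ <-> sat n ψ.
  by move=> tφ; apply/evalP/tφ.
elim: ψ => [q||ψ IHψ χ IHχ|ψ _|ψ _|ψ _ χ _|ψ _ χ _|t i ψ _|s i ψ _];
  try by split=> /asboolP.
- by [].
- split=> [/implyP H /IHψ/H/IHχ // | H]; apply/implyP => /IHψ h.
  exact/IHχ/H.
Qed.

Lemma sat_until_fix n φ ψ :
  sat n (Until φ ψ) <-> sat n ψ \/ (sat n φ /\ sat n.+1 (Until φ ψ)).
Proof.
split=> [[m [le_nm hψ hφ]] | [hψ | [hφn [m [lt_nm hψ hφ]]]]].
- move: le_nm; rewrite leq_eqVlt => /predU1P[->|lt_nm]; first by left.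
  right; split; first by apply: hφ; rewrite leqnn.
  by exists m; split=> // k /andP[/ltnW le_nk lt_km]; apply: hφ; apply/andP.
- exists n; split=> // k /andP[le_nk lt_kn].
  by have := leq_ltn_trans le_nk lt_kn; rewrite ltnn.
- exists m; split=> [|//|k /andP[]]; first exact: ltnW.
  rewrite leq_eqVlt => /predU1P[<- // | lt_nk lt_km].
  by apply: hφ; apply/andP.
Qed.

Lemma sat_since_fix n φ ψ :
  sat n (Since φ ψ) <->
  sat n ψ \/ (sat n φ /\ (0 < n /\ sat n.-1 (Since φ ψ))).
Proof.
split=> [[m [le_mn hψ hφ]] | [hψ | [hφn [n_gt0 [m [le_mn hψ hφ]]]]]].
- move: le_mn; rewrite leq_eqVlt => /predU1P[<-|lt_mn]; first by left.
  right; split; first by apply: hφ; rewrite lt_mn leqnn.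
  case: n lt_mn hφ => [//|n] lt_mn hφ; split=> //.
  exists m; split=> // k /andP[lt_mk le_kn].
  by apply: hφ; rewrite lt_mk leqW.
- exists n; split=> // k /andP[lt_nk le_kn].
  by have := leq_trans lt_nk le_kn; rewrite ltnn.
- case: n n_gt0 hφn le_mn hφ => [//|n] _ hφn le_mn hφ.
  exists m; split=> [|//|k /andP[lt_mk]]; first exact: leqW.
  rewrite leq_eqVlt => /predU1P[-> // | le_kn].
  by apply: hφ; apply/andP.
Qed.

Lemma sat_axiom n φ : Defs.axiom φ -> sat n φ.
Proof.
move=> axφ; elim: axφ n => {φ}.
- by move=> φ tφ n; apply: sat_tautology.
- by move=> φ ψ n; apply.
- move=> φ ψ n; apply: sat_imp => /sat_henceforth H.
  apply: sat_imp => /sat_henceforth hφ; apply/sat_henceforth.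
  by move=> m le_nm; apply: H (hφ m le_nm).
- move=> φ ψ n; apply: sat_imp => /sat_hitherto H.
  apply: sat_imp => /sat_hitherto hφ; apply/sat_hitherto.
  by move=> m le_mn; apply: H (hφ m le_mn).
- by move=> φ ψ [|n] //=; apply.
- by move=> φ n; apply/sat_iff.
- move=> φ n; apply: sat_imp => /sat_henceforth H hφ; apply/sat_henceforth => m.
  elim: m => [|m IHm]; first by rewrite leqn0 => /eqP <-.
  rewrite leq_eqVlt => /predU1P[<- // | le_nm].
  exact: H le_nm (IHm le_nm).
- by move=> φ ψ n [m [le_nm hψ _]]; exists m; split=> // ? _.
- by move=> φ ψ n; apply/sat_iff; rewrite sat_or sat_and; apply: sat_until_fix.
- by move=> φ [|n] //; apply: sat_imp => /sat_sprev[].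
- by move=> n; exists 0; split=> // ? _.
- move=> φ n; apply: sat_imp => /sat_hitherto H hφ.
  apply/sat_hitherto => m le_mn.
  (* Writing [m] as [n - k] turns the claim into an induction that descends from [n], the direction
     in which [WPrev] carries truth. *)
  rewrite -(subKn le_mn); elim: (n - m) => [|k IHk]; first by rewrite subn0.
  rewrite subnS; have := H (n - k) (leq_subr _ _) IHk.
  (* When [n - k] is 0, its truncated predecessor is 0 again and the induction hypothesis
     suffices. *)
  by case: (n - k) IHk.
- by move=> φ ψ n [m [le_mn hψ _]]; exists m; split=> // ? _.
- move=> φ ψ n; apply/sat_iff; rewrite sat_or sat_and sat_sprev.
  exact: sat_since_fix.
- by move=> φ n hφ; apply/(sat_sprev n.+1).
- by move=> φ [|n].
- by move=> t s i φ ψ n; apply.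
- by move=> t s i φ n.
- by move=> t s i φ n.
- by move=> t i φ n.
- by move=> t i φ n.
(* [NApp t s] is never a variable, so only the truth of [ψ] is at stake; likewise for [NDagger t]
   below. *)
- by move=> t s i φ ψ n [_ H] [_ /H hψ].
- by move=> t i φ n [_ hφ] [_]; apply.
- by move=> t i φ n; split=> // -[].
Qed.

(** Soundness. The instant stays general in the induction because necessitation passes to other
    instants. *)
Lemma sat_provable (CS : set (formula L)) φ n :
  constant_specification CS -> provable CS φ -> sat n φ.
Proof.
move=> hCS prφ; elim: prφ n => {φ}
  [φ axφ|φ /(cs_form hCS)[l [ψ [_ [axψ chain]]]]|φ ψ _ IH _ IHφ|φ _ IH|φ _ IH
  |φ _ IH|φ _ IH] n.
- exact: sat_axiom.
(* Chains contain only constants, which are factive here, so peeling them off leaves an axiom. *)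
- by case: chain => ->; elim: l => [|ci l IHl] //=; apply: sat_axiom.
- exact: IH (IHφ n).
- exact: IH.
- by case: n => //= n; apply: IH.
- by apply/sat_henceforth => m _; apply: IH.
- by apply/sat_hitherto => m _; apply: IH.
Qed.

Lemma sat_conj_seq n (l : seq (formula L)) :
  List.Forall (sat n) l -> sat n (conj_seq l).
Proof.
elim=> [|φ [|ψ l'] hφ _ IHl] //.
exact/sat_and.
Qed.

Lemma sat_wuntil_now n φ ψ : sat n ψ -> sat n (WUntil φ ψ).
Proof. by move=> hψ; apply/sat_or; left; apply/sat_until_fix; left. Qed.

Lemma sat_pay n : sat n (Atom (pay L)).
Proof.
by have /and3P[_] := atoms_distinct L; rewrite /= !inE eq_sym.
Qed.

Lemma sat_win_p n : sat n (Atom (win_p L)).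
Proof. by have /= := atoms_distinct L; rewrite !inE => /andP[/norP[]]. Qed.

Lemma sat_winfirst_e n : ~ sat n (Atom (winfirst_e L)).
Proof. by rewrite /= eqxx. Qed.

Lemma sat_contract' n : sat n (contract' L).
Proof.
apply: sat_always => m; apply/sat_and; split.
  (* Since [winfirst_e] never happens, the weak until must hold through its [□] disjunct. *)
  by apply/sat_or; right; apply/sat_henceforth => k _ [].
by move/sat_winfirst_e.
Qed.

Lemma sat_court' n : sat n (court' L).
Proof.
apply: sat_always => m; apply: sat_imp => _.
apply/sat_and; split; last (apply/sat_and; split).
- by apply/sat_iff; split=> [/(_ (sat_win_p m)) | /sat_winfirst_e].
(* [pay] holds already, so the weak until ends before [v_p] has to oblige anyone. *)
- by move=> _; apply/sat_wuntil_now/sat_pay.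
- by move=> /(_ (sat_win_p m)).
Qed.

End Satisfaction.

Theorem lemma7p3 (L : language) (CS : set (formula L))
    (hCS : constant_specification CS) :
  consistent CS [set contract' L; court' L; time_is 10].
Proof.
(* Instant 10 is forced by [time_is 10]; the other two premises hold at every instant. *)
move=> [l [lT prl]]; apply: (sat_provable CS _ 10 hCS prl); apply: sat_conj_seq.
apply: List.Forall_impl lT => φ [[-> | ->] | ->].
- exact: sat_contract'.
- exact: sat_court'.
- exact: sat_time_is.
Qed.
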